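(* For any braided strict monoidal category $\mathcal{C}$ with braiding $c$, the category $YB(\mathcal{C})$ of Yang-Baxter objects of $\mathcal{C}$ is a strict monoidal category under the lashing product $(X,\chi)\boxtimes(Y,\gamma)=(X\otimes Y,\chi\boxtimes\gamma)$ (acting on morphisms by $(f,g)\mapsto f\otimes g$), with monoidal unit $(\mathbf{1},\mathrm{id}_{\mathbf{1}})$.
   Context: Let $\mathcal{C}=(\mathcal{C},\otimes,\mathbf{1})$ be a strict monoidal category. A Yang-Baxter object of $\mathcal{C}$ is a pair $(X,\chi)$ with $X$ an object of $\mathcal{C}$ and $\chi\in\mathcal{C}(X\otimes X,X\otimes X)$ an invertible morphism with $(\chi\otimes\mathrm{id}_X)(\mathrm{id}_X\otimes\chi)(\chi\otimes\mathrm{id}_X)=(\mathrm{id}_X\otimes\chi)(\chi\otimes\mathrm{id}_X)(\mathrm{id}_X\otimes\chi)$. The category $YB(\mathcal{C})$ has Yang-Baxter objects as objects, and a morphism $(X,\chi)\to(Y,\gamma)$ is an $f\in\mathcal{C}(X,Y)$ with $\gamma(f\otimes f)=(f\otimes f)\chi$; composition is that of $\mathcal{C}$. A braiding $c$ on $\mathcal{C}$ is a natural isomorphism $c_{X,Y}:X\otimes Y\to Y\otimes X$ satisfying $c_{X,Y\otimes Z}=(\mathrm{id}_Y\otimes c_{X,Z})(c_{X,Y}\otimes\mathrm{id}_Z)$ and $c_{X\otimes Y,Z}=(c_{X,Z}\otimes\mathrm{id}_Y)(\mathrm{id}_X\otimes c_{Y,Z})$ (not assumed symmetric). The lashing product of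 $(X,\chi),(Y,\gamma)\in YB(\mathcal{C})$ is $(X\otimes Y,\chi\boxtimes\gamma)$ where $$\chi\boxtimes\gamma=(\mathrm{id}_X\otimes c_{Y,X}^{-1}\otimes\mathrm{id}_Y)(\chi\otimes\gamma)(\mathrm{id}_X\otimes c_{Y,X}\otimes\mathrm{id}_Y)\in\mathcal{C}\big((X\otimes Y)^{\otimes 2},(X\otimes Y)^{\otimes 2}\big).$$ *)

(* Defs.v *)
From Stdlib Require Import ProofIrrelevance.

Set Implicit Arguments.
Unset Strict Implicit.
Unset Printing Implicit Defensive.

Declare Scope cat_scope.
Delimit Scope cat_scope with cat.
Local Open Scope cat_scope.

Reserved Notation "g \oc f" (at level 40, left associativity).
Reserved Notation "X \ox Y" (at level 35, right associativity).
Reserved Notation "f \hx g" (at level 35, right associativity).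

Record category := Category {
  ob :> Type;
  hom : ob -> ob -> Type;
  idm : forall X, hom X X;
  comp : forall X Y Z, hom Y Z -> hom X Y -> hom X Z;
  comp_idl : forall X Y (f : hom X Y), comp (idm Y) f = f;
  comp_idr : forall X Y (f : hom X Y), comp f (idm X) = f;
  compA : forall W X Y Z (h : hom Y Z) (g : hom X Y) (f : hom W X),
    comp h (comp g f) = comp (comp h g) f
}.

Arguments hom {c} X Y.
Arguments idm {c} X.
Arguments comp {c X Y Z} g f.

Notation "g \oc f" := (comp g f) : cat_scope.

(* A morphism bundled with its source and target.  Two morphisms of a strict
   monoidal category whose sources and targets are equal, though not
   convertible, are equal when they are equal as arrows. *)
Record arrow (C : category) := Arrow {
  src : C;
  tgt : C;
  mor : hom src tgt
}.

Arguments Arrow {C src tgt} mor.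

(* A morphism, regarded as a morphism between equal objects. *)
Definition hom_cast (C : category) (X X' Y Y' : C) (eX : X = X') (eY : Y = Y')
    (f : hom X Y) : hom X' Y' :=
  eq_rect Y (fun T => hom X' T) (eq_rect X (fun S => hom S Y) f X' eX) Y' eY.

Record iso (C : category) (X Y : C) := Iso {
  fwd :> hom X Y;
  bwd : hom Y X;
  bwdK : bwd \oc fwd = idm X;
  fwdK : fwd \oc bwd = idm Y
}.

Definition invertible (C : category) (X Y : C) (f : hom X Y) : Prop :=
  exists g : hom Y X, g \oc f = idm X /\ f \oc g = idm Y.

Record tensor_data (C : category) := TensorData {
  tensor_ob : C -> C -> C;
  tensor_unit : C;
  tensor_mor : forall X X' Y Y' : C,
    hom X X' -> hom Y Y' -> hom (tensor_ob X Y) (tensor_ob X' Y')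
}.

Arguments tensor_mor {C} t {X X' Y Y'} f g.

Record is_strict_monoidal (C : category) (T : tensor_data C) : Prop :=
    IsStrictMonoidal {
  ax_tensor_id : forall X Y : C,
    tensor_mor T (idm X) (idm Y) = idm (tensor_ob T X Y);
  ax_tensor_comp : forall (X X' X'' Y Y' Y'' : C)
      (f' : hom X' X'') (f : hom X X') (g' : hom Y' Y'') (g : hom Y Y'),
    tensor_mor T (f' \oc f) (g' \oc g) = tensor_mor T f' g' \oc tensor_mor T f g;
  ax_tensorA_ob : forall X Y Z : C,
    tensor_ob T X (tensor_ob T Y Z) = tensor_ob T (tensor_ob T X Y) Z;
  ax_tensor1l_ob : forall X : C, tensor_ob T (tensor_unit T) X = X;
  ax_tensor1r_ob : forall X : C, tensor_ob T X (tensor_unit T) = X;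
  ax_tensorA_mor : forall (X X' Y Y' Z Z' : C)
      (f : hom X X') (g : hom Y Y') (h : hom Z Z'),
    Arrow (tensor_mor T f (tensor_mor T g h)) =
    Arrow (tensor_mor T (tensor_mor T f g) h);
  ax_tensor1l_mor : forall (X X' : C) (f : hom X X'),
    Arrow (tensor_mor T (idm (tensor_unit T)) f) = Arrow f;
  ax_tensor1r_mor : forall (X X' : C) (f : hom X X'),
    Arrow (tensor_mor T f (idm (tensor_unit T))) = Arrow f
}.

Record strict_monoidal_category := StrictMonoidalCategory {
  smc_cat :> category;
  smc_tensor : tensor_data smc_cat;
  smc_ax : is_strict_monoidal smc_tensor
}.

Notation "X \ox Y" := (tensor_ob (smc_tensor _) X Y) : cat_scope.
Notation "f \hx g" := (tensor_mor (smc_tensor _) f g) : cat_scope.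
Notation unit_ob C := (tensor_unit (smc_tensor C)).

Section Tensor.

Variable C : strict_monoidal_category.

Lemma tensorA (X Y Z : C) : X \ox (Y \ox Z) = (X \ox Y) \ox Z.
Proof. exact (ax_tensorA_ob (smc_ax C) X Y Z). Qed.

Lemma tensor_mid (X Y Z W : C) :
  (X \ox (Y \ox Z)) \ox W = (X \ox Y) \ox (Z \ox W).
Proof. rewrite tensorA; symmetry; apply tensorA. Qed.

(* id_X ⊗ f ⊗ id_W *)
Definition mid_mor (X Y Y' Z Z' W : C) (f : hom (Y \ox Z) (Y' \ox Z')) :
    hom ((X \ox Y) \ox (Z \ox W)) ((X \ox Y') \ox (Z' \ox W)) :=
  hom_cast (tensor_mid X Y Z W) (tensor_mid X Y' Z' W)
    ((idm X \hx f) \hx idm W).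

End Tensor.

Record braiding (C : strict_monoidal_category) := Braiding {
  braid :> forall X Y : C, iso (X \ox Y) (Y \ox X);
  braid_natural : forall (X X' Y Y' : C) (f : hom X X') (g : hom Y Y'),
    braid X' Y' \oc (f \hx g) = (g \hx f) \oc braid X Y;
  braid_tensor_r : forall X Y Z : C,
    hom_cast (tensorA X Y Z) (eq_sym (tensorA Y Z X)) (braid X (Y \ox Z)) =
    (idm Y \hx braid X Z) \oc
      hom_cast eq_refl (eq_sym (tensorA Y X Z)) (braid X Y \hx idm Z);
  braid_tensor_l : forall X Y Z : C,
    hom_cast (eq_sym (tensorA X Y Z)) (tensorA Z X Y) (braid (X \ox Y) Z) =
    (braid X Z \hx idm Y) \oc
      hom_cast eq_refl (tensorA X Z Y) (idm X \hx braid Y Z)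
}.

Section YangBaxter.

Variable C : strict_monoidal_category.

Definition yang_baxter_equation (X : C) (chi : hom (X \ox X) (X \ox X)) : Prop :=
  let chi1 : hom ((X \ox X) \ox X) ((X \ox X) \ox X) := chi \hx idm X in
  let chi2 : hom ((X \ox X) \ox X) ((X \ox X) \ox X) :=
    hom_cast (tensorA X X X) (tensorA X X X) (idm X \hx chi) in
  chi1 \oc chi2 \oc chi1 = chi2 \oc chi1 \oc chi2.

Definition is_yang_baxter (X : C) (chi : hom (X \ox X) (X \ox X)) : Prop :=
  invertible chi /\ yang_baxter_equation chi.

Record YB_ob := YBOb {
  yb_ob : C;
  yb_chi : hom (yb_ob \ox yb_ob) (yb_ob \ox yb_ob);
  yb_ax : is_yang_baxter yb_chi
}.

Definition is_YB_mor (A B : YB_ob) (f : hom (yb_ob A) (yb_ob B)) : Prop :=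
  yb_chi B \oc (f \hx f) = (f \hx f) \oc yb_chi A.

Record YB_hom (A B : YB_ob) := YBHom {
  yb_mor :> hom (yb_ob A) (yb_ob B);
  yb_mor_ax : is_YB_mor yb_mor
}.

Lemma YB_hom_eq (A B : YB_ob) (f g : YB_hom A B) : yb_mor f = yb_mor g -> f = g.
Proof.
destruct f as [f pf], g as [g pg]; simpl; intros e; subst g.
f_equal; apply proof_irrelevance.
Qed.

Lemma YB_id_ax (A : YB_ob) : is_YB_mor (A := A) (B := A) (idm (yb_ob A)).
Proof.
unfold is_YB_mor.
now rewrite (ax_tensor_id (smc_ax C)), comp_idl, comp_idr.
Qed.

Lemma YB_comp_ax (A B D : YB_ob) (g : YB_hom B D) (f : YB_hom A B) :
  is_YB_mor (A := A) (B := D) (yb_mor g \oc yb_mor f).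
Proof.
unfold is_YB_mor; rewrite (ax_tensor_comp (smc_ax C)).
now rewrite compA, (yb_mor_ax g), <- compA, (yb_mor_ax f), compA.
Qed.

Definition YB_id (A : YB_ob) : YB_hom A A := YBHom (YB_id_ax A).

Definition YB_comp (A B D : YB_ob) (g : YB_hom B D) (f : YB_hom A B) :
    YB_hom A D :=
  YBHom (YB_comp_ax g f).

Lemma YB_comp_idl (A B : YB_ob) (f : YB_hom A B) : YB_comp (YB_id B) f = f.
Proof. apply YB_hom_eq, comp_idl. Qed.

Lemma YB_comp_idr (A B : YB_ob) (f : YB_hom A B) : YB_comp f (YB_id A) = f.
Proof. apply YB_hom_eq, comp_idr. Qed.

Lemma YB_compA (A B D E : YB_ob)
    (h : YB_hom D E) (g : YB_hom B D) (f : YB_hom A B) :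
  YB_comp h (YB_comp g f) = YB_comp (YB_comp h g) f.
Proof. apply YB_hom_eq, compA. Qed.

Definition YB : category := Category YB_comp_idl YB_comp_idr YB_compA.

Variable c : braiding C.

Definition lash (X Y : C)
    (chi : hom (X \ox X) (X \ox X)) (gamma : hom (Y \ox Y) (Y \ox Y)) :
    hom ((X \ox Y) \ox (X \ox Y)) ((X \ox Y) \ox (X \ox Y)) :=
  mid_mor X Y (bwd (c Y X)) \oc (chi \hx gamma) \oc mid_mor X Y (fwd (c Y X)).

(* The closure properties under which the lashing product, the unit and the
   tensor product of morphisms make sense in YB. *)
Definition lash_closed : Prop :=
  forall A B : YB_ob, is_yang_baxter (lash (yb_chi A) (yb_chi B)).

(* id_1 as an endomorphism of 1 ⊗ 1 = 1 *)
Definition unit_chi : hom (unit_ob C \ox unit_ob C) (unit_ob C \ox unit_ob C) :=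
  hom_cast (eq_sym (ax_tensor1l_ob (smc_ax C) (unit_ob C)))
           (eq_sym (ax_tensor1l_ob (smc_ax C) (unit_ob C))) (idm (unit_ob C)).

Definition unit_closed : Prop := is_yang_baxter unit_chi.

Definition lash_ob (H : lash_closed) (A B : YB_ob) : YB_ob := YBOb (H A B).

Definition tensor_mor_closed (H : lash_closed) : Prop :=
  forall (A A' B B' : YB_ob) (f : YB_hom A A') (g : YB_hom B B'),
    is_YB_mor (A := lash_ob H A B) (B := lash_ob H A' B')
      (yb_mor f \hx yb_mor g).

Definition lashing_tensor (H : lash_closed) (H1 : unit_closed)
    (Hm : tensor_mor_closed H) : tensor_data YB :=
  @TensorData YB (lash_ob H) (YBOb H1)
    (fun A A' B B' f g => YBHom (Hm A A' B B' f g)).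

End YangBaxter.

(* Main.v *)
(** All equations are between arrows with explicit endpoints, so that the tensor
   product becomes strictly associative and unital without casts.  Writing [s]
   for [id_X ⊗ c_{Y,X} ⊗ id_Y], the lashing product is the only arrow [l] with
   [s l = (χ ⊗ γ) s].  Hence an identity between lashing products may be checked
   after transport along an invertible rearrangement of the factors, such as
   [XYXYXY -> XXXYYY] for the Yang-Baxter equation or [XYZXYZ -> XXYYZZ] for
   associativity.  Each of these rearrangements is built in two ways, which
   agree by the hexagon axioms and the interchange law. *)

From Stdlib Require Import ProofIrrelevance ClassicalEpsilon.
Require Import Defs.

Set Implicit Arguments.
Unset Strict Implicit.
Unset Printing Implicit Defensive.

Local Open Scope cat_scope.

Reserved Notation "g \ac f" (at level 40, left associativity).
Reserved Notation "f \ax g" (at level 36, left associativity).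

(** * Arrows with explicit endpoints: composition, invertibility, commutative squares *)

Section Arrows.

Variable C : category.

(** An equality of arrows transports [f] to [g] along loops [X = X] and [Y = Y], which proof
    irrelevance makes trivial. *)
Lemma Arrow_inj (X Y : C) (f g : hom X Y) : Arrow f = Arrow g -> f = g.
Proof.
intros e.
assert (H : forall (a b : arrow C) (e : a = b),
  mor b = hom_cast (f_equal (@src C) e) (f_equal (@tgt C) e) (mor a)).
{ intros a b []; reflexivity. }
specialize (H _ _ e); cbn in H.
revert H; generalize (f_equal (@src C) e) (f_equal (@tgt C) e); simpl.
intros p q; now rewrite (proof_irrelevance _ p eq_refl),
  (proof_irrelevance _ q eq_refl).
Qed.

Lemma Arrow_cast (X X' Y Y' : C) (eX : X = X') (eY : Y = Y') (f : hom X Y) :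
  Arrow (hom_cast eX eY f) = Arrow f.
Proof. now destruct eX, eY. Qed.

Definition aid (X : C) : arrow C := Arrow (idm X).

(* The junk value on arrows that are not composable is [f], so that
   [src (acomp g f) = src f] always holds. *)
Definition acomp (g f : arrow C) : arrow C :=
  match excluded_middle_informative (tgt f = src g) with
  | left e => Arrow (mor g \oc hom_cast eq_refl e (mor f))
  | right _ => f
  end.

Notation "g \ac f" := (acomp g f).

Lemma Arrow_comp (X Y Z : C) (g : hom Y Z) (f : hom X Y) :
  Arrow (g \oc f) = Arrow g \ac Arrow f.
Proof.
unfold acomp; destruct excluded_middle_informative as [e|n]; simpl in *.
- now rewrite (proof_irrelevance _ e eq_refl).
- now destruct n.
Qed.

Lemma src_acomp (g f : arrow C) : src (g \ac f) = src f.
Proof. now unfold acomp; destruct excluded_middle_informative. Qed.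

Lemma tgt_acomp (g f : arrow C) : tgt f = src g -> tgt (g \ac f) = tgt g.
Proof. now unfold acomp; destruct excluded_middle_informative. Qed.

Lemma acompA (h g f : arrow C) : tgt f = src g -> tgt g = src h ->
  h \ac (g \ac f) = h \ac g \ac f.
Proof.
destruct f as [X Y f], g as [Y' Z g], h as [Z' W h]; simpl.
intros e e'; destruct e, e'.
now rewrite <- !Arrow_comp, compA.
Qed.

Lemma acomp_idl (X : C) (f : arrow C) : tgt f = X -> aid X \ac f = f.
Proof.
destruct f as [Y Z f]; simpl; intros e; subst X.
unfold aid; now rewrite <- Arrow_comp, comp_idl.
Qed.

Lemma acomp_idr (X : C) (f : arrow C) : src f = X -> f \ac aid X = f.
Proof.
destruct f as [Y Z f]; simpl; intros e; subst X.
unfold aid; now rewrite <- Arrow_comp, comp_idr.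
Qed.

Lemma invertible_idm (X : C) : invertible (idm X).
Proof. exists (idm X); now rewrite comp_idl. Qed.

Lemma invertible_comp (X Y Z : C) (g : hom Y Z) (f : hom X Y) :
  invertible g -> invertible f -> invertible (g \oc f).
Proof.
intros [g' [gl gr]] [f' [fl fr]]; exists (f' \oc g'); split.
- now rewrite compA, <- (compA f'), gl, comp_idr.
- now rewrite compA, <- (compA g), fr, comp_idr.
Qed.

Lemma invertible_cast (X X' Y Y' : C) (eX : X = X') (eY : Y = Y')
    (f : hom X Y) : invertible f -> invertible (hom_cast eX eY f).
Proof. now destruct eX, eY. Qed.

Lemma invertible_acomp (g f : arrow C) :
  invertible (mor g) -> invertible (mor f) -> invertible (mor (g \ac f)).
Proof.
intros ig jf; unfold acomp; destruct excluded_middle_informative; simpl; auto.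
now apply invertible_comp; [|apply invertible_cast].
Qed.

Lemma acomp_cancel (p f f' : arrow C) :
  invertible (mor p) -> tgt f = src p -> tgt f' = src p ->
  p \ac f = p \ac f' -> f = f'.
Proof.
intros [q [qp _]] tf tf' e.
assert (H : Arrow q \ac p = aid (src p)).
{ destruct p; simpl in *; unfold aid; now rewrite <- qp, Arrow_comp. }
rewrite <- (acomp_idl tf), <- (acomp_idl tf'), <- H.
rewrite <- !acompA by (simpl; congruence).
now rewrite e.
Qed.

(* The commutative square with top edge [f], bottom edge [g], left edge [p] and
   right edge [q]. *)
Record square (p q f g : arrow C) : Prop := Square {
  sq_nw : src f = src p;
  sq_ne : tgt f = src q;
  sq_sw : tgt p = src g;
  sq_se : tgt q = tgt g;
  sq_comm : q \ac f = g \ac p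
}.

Lemma square_idv (f : arrow C) : square (aid (src f)) (aid (tgt f)) f f.
Proof. split; try reflexivity; now rewrite acomp_idl, acomp_idr. Qed.

(** The edges to be glued often agree only after reassociating tensor products, so their equality is
    a premise, as is that of the two forms of the bottom edge. *)
Lemma square_vcomp (p q p' q' f g g' h h' : arrow C) :
  square p q f g -> square p' q' g' h -> g = g' -> h = h' ->
  square (p' \ac p) (q' \ac q) f h'.
Proof.
intros s t e e'; subst g' h'; revert s t; intros [s1 s2 s3 s4 s5] [t1 t2 t3 t4 t5].
split; rewrite ?src_acomp, ?tgt_acomp; try congruence.
rewrite <- acompA, s5, acompA, t5, acompA by congruence; reflexivity.
Qed.

Lemma square_hcomp (p q r f g f' g' : arrow C) :
  square p q f g -> square q r f' g' -> square p r (f' \ac f) (g' \ac g).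
Proof.
intros [s1 s2 s3 s4 s5] [t1 t2 t3 t4 t5].
split; rewrite ?src_acomp, ?tgt_acomp; try congruence.
rewrite acompA, t5, <- acompA, s5, acompA by congruence; reflexivity.
Qed.

(** The other three edges determine the top one; this carries out the transport of identities along
    an invertible rearrangement. *)
Lemma square_cancel (p q f f' g : arrow C) :
  invertible (mor q) -> square p q f g -> square p q f' g -> f = f'.
Proof.
intros iq [s1 s2 s3 s4 s5] [t1 t2 t3 t4 t5].
apply (acomp_cancel (p := q)); congruence.
Qed.

End Arrows.

Notation "g \ac f" := (acomp g f) : cat_scope.

(** * Strict tensor product of arrows *)

Section Tensor.

Variable C : strict_monoidal_category.

Definition atens (f g : arrow C) : arrow C := Arrow (mor f \hx mor g).

Notation "f \ax g" := (atens f g) : cat_scope.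
Notation one := (unit_ob C).

Lemma atensA (f g h : arrow C) : f \ax (g \ax h) = f \ax g \ax h.
Proof. apply (ax_tensorA_mor (smc_ax C)). Qed.

Lemma atens1l (f : arrow C) : aid one \ax f = f.
Proof. destruct f; apply (ax_tensor1l_mor (smc_ax C)). Qed.

Lemma atens1r (f : arrow C) : f \ax aid one = f.
Proof. destruct f; apply (ax_tensor1r_mor (smc_ax C)). Qed.

Lemma tensor1l (X : C) : one \ox X = X.
Proof. apply (ax_tensor1l_ob (smc_ax C)). Qed.

Lemma tensor1r (X : C) : X \ox one = X.
Proof. apply (ax_tensor1r_ob (smc_ax C)). Qed.

Lemma aid_tens (X Y : C) : aid (X \ox Y) = aid X \ax aid Y.
Proof. unfold aid, atens; simpl; now rewrite (ax_tensor_id (smc_ax C)). Qed.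

Lemma atens_comp (f' f g' g : arrow C) : tgt f = src f' -> tgt g = src g' ->
  (f' \ac f) \ax (g' \ac g) = (f' \ax g') \ac (f \ax g).
Proof.
destruct f as [X Y f], g as [Z W g], f' as [Y' V f'], g' as [W' U g']; simpl.
intros e e'; destruct e, e'; unfold atens.
rewrite <- !Arrow_comp; simpl; now rewrite (ax_tensor_comp (smc_ax C)).
Qed.

Lemma atens_comp_idl (X : C) (g' g : arrow C) : tgt g = src g' ->
  aid X \ax (g' \ac g) = (aid X \ax g') \ac (aid X \ax g).
Proof. intros e; rewrite <- atens_comp by easy; now rewrite acomp_idl. Qed.

Lemma atens_comp_idr (X : C) (f' f : arrow C) : tgt f = src f' ->
  (f' \ac f) \ax aid X = (f' \ax aid X) \ac (f \ax aid X).
Proof. intros e; rewrite <- atens_comp by easy; now rewrite acomp_idl. Qed.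

Lemma invertible_tensor (X X' Y Y' : C) (f : hom X X') (g : hom Y Y') :
  invertible f -> invertible g -> invertible (f \hx g).
Proof.
intros [f' [fl fr]] [g' [gl gr]]; exists (f' \hx g').
rewrite <- !(ax_tensor_comp (smc_ax C)), fl, fr, gl, gr.
split; apply (ax_tensor_id (smc_ax C)).
Qed.

(** Both composites equal [f \ax g]. *)
Lemma atens_interchange (f g : arrow C) :
  (aid (tgt f) \ax g) \ac (f \ax aid (src g)) =
  (f \ax aid (tgt g)) \ac (aid (src f) \ax g).
Proof.
rewrite <- !atens_comp by easy.
now rewrite !acomp_idl, !acomp_idr by easy.
Qed.

Lemma square_tens (p q f g p' q' f' g' : arrow C) :
  square p q f g -> square p' q' f' g' ->
  square (p \ax p') (q \ax q') (f \ax f') (g \ax g').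
Proof.
intros [s1 s2 s3 s4 s5] [t1 t2 t3 t4 t5].
split; simpl; try congruence.
rewrite <- !atens_comp by congruence; congruence.
Qed.

Lemma Arrow_mid (X Y Y' Z Z' W : C) (f : hom (Y \ox Z) (Y' \ox Z')) :
  Arrow (mid_mor X W f) = aid X \ax Arrow f \ax aid W.
Proof. apply Arrow_cast. Qed.

Lemma mid_mor_comp (X Y Y' Y'' Z Z' Z'' W : C)
    (g : hom (Y' \ox Z') (Y'' \ox Z'')) (f : hom (Y \ox Z) (Y' \ox Z')) :
  mid_mor X W g \oc mid_mor X W f = mid_mor X W (g \oc f).
Proof.
apply Arrow_inj; rewrite Arrow_comp, !Arrow_mid, Arrow_comp.
now rewrite atens_comp_idl, atens_comp_idr.
Qed.

Lemma mid_mor_id (X Y Z W : C) : mid_mor X W (idm (Y \ox Z)) = idm _.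
Proof.
apply Arrow_inj; rewrite Arrow_mid.
change (aid X \ax aid (Y \ox Z) \ax aid W = aid ((X \ox Y) \ox (Z \ox W))).
now rewrite !aid_tens, !atensA.
Qed.

Lemma invertible_mid (X Y Y' Z Z' W : C) (f : hom (Y \ox Z) (Y' \ox Z')) :
  invertible f -> invertible (mid_mor X W f).
Proof.
intros H; apply invertible_cast.
repeat apply invertible_tensor; auto using invertible_idm.
Qed.

Lemma yang_baxter_equationE (X : C) (chi : hom (X \ox X) (X \ox X)) :
  yang_baxter_equation chi <->
  (Arrow chi \ax aid X) \ac (aid X \ax Arrow chi) \ac (Arrow chi \ax aid X) =
  (aid X \ax Arrow chi) \ac (Arrow chi \ax aid X) \ac (aid X \ax Arrow chi).
Proof.
unfold yang_baxter_equation; split; intros e.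
- apply (f_equal Arrow) in e; now rewrite !Arrow_comp, !Arrow_cast in e.
- apply Arrow_inj; now rewrite !Arrow_comp, !Arrow_cast.
Qed.

(** * The braiding on arrows and its value at the unit *)

Section Braiding.

Variable c : braiding C.

Definition abraid (X Y : C) : arrow C := Arrow (fwd (c X Y)).

Lemma abraid_tensor_r (X Y Z : C) :
  abraid X (Y \ox Z) = (aid Y \ax abraid X Z) \ac (abraid X Y \ax aid Z).
Proof.
pose proof (f_equal Arrow (braid_tensor_r c X Y Z)) as e.
now rewrite Arrow_cast, Arrow_comp, Arrow_cast in e.
Qed.

Lemma abraid_tensor_l (X Y Z : C) :
  abraid (X \ox Y) Z = (abraid X Z \ax aid Y) \ac (aid X \ax abraid Y Z).
Proof.
pose proof (f_equal Arrow (braid_tensor_l c X Y Z)) as e.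
now rewrite Arrow_cast, Arrow_comp, Arrow_cast in e.
Qed.

Lemma invertible_abraid (X Y : C) : invertible (mor (abraid X Y)).
Proof. exists (bwd (c X Y)); split; [apply bwdK | apply fwdK]. Qed.

(* The hexagon axiom at [1 = 1 ⊗ 1] makes the braiding an invertible
   idempotent. *)
Lemma abraid1r (X : C) : abraid X one = aid X.
Proof.
pose proof (abraid_tensor_r X one one) as e.
rewrite (tensor1l one), atens1l, atens1r in e.
apply (acomp_cancel (p := abraid X one));
  [apply invertible_abraid | simpl; now rewrite tensor1l, tensor1r |
    simpl; now rewrite ?tensor1l, ?tensor1r |].
rewrite <- e; symmetry; apply acomp_idr, tensor1r.
Qed.

Lemma abraid1l (X : C) : abraid one X = aid X.
Proof.
pose proof (abraid_tensor_l one one X) as e.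
rewrite (tensor1l one), atens1l, atens1r in e.
apply (acomp_cancel (p := abraid one X));
  [apply invertible_abraid | simpl; now rewrite tensor1l, tensor1r |
    simpl; now rewrite ?tensor1l, ?tensor1r |].
rewrite <- e; symmetry; apply acomp_idr, tensor1l.
Qed.

Lemma square_braid (f g : arrow C) :
  square (abraid (src f) (src g)) (abraid (tgt f) (tgt g)) (f \ax g) (g \ax f).
Proof.
split; try reflexivity.
unfold abraid, atens; now rewrite <- !Arrow_comp, braid_natural.
Qed.

(** * The lashing product as a commutative square *)

Definition swap_mid (X Y : C) : arrow C := aid X \ax abraid Y X \ax aid Y.

Lemma invertible_swap_mid (X Y : C) : invertible (mor (swap_mid X Y)).
Proof.
repeat apply invertible_tensor; auto using invertible_idm, invertible_abraid.
Qed.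

(** The inverse braiding that [lash] applies last is cancelled by the braiding in [swap_mid]. *)
Lemma square_lash (X Y : C)
    (chi : hom (X \ox X) (X \ox X)) (gamma : hom (Y \ox Y) (Y \ox Y)) :
  square (swap_mid X Y) (swap_mid X Y)
    (Arrow (lash c chi gamma)) (Arrow chi \ax Arrow gamma).
Proof.
unfold swap_mid, abraid; rewrite <- Arrow_mid.
split; try reflexivity.
unfold atens, lash; rewrite <- !Arrow_comp; f_equal; simpl.
now rewrite !compA, mid_mor_comp, fwdK, mid_mor_id, comp_idl.
Qed.

Lemma invertible_lash (X Y : C)
    (chi : hom (X \ox X) (X \ox X)) (gamma : hom (Y \ox Y) (Y \ox Y)) :
  invertible chi -> invertible gamma -> invertible (lash c chi gamma).
Proof.
intros ichi igamma; unfold lash.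
repeat apply invertible_comp; try apply invertible_mid.
- exists (fwd (c Y X)); split; [apply fwdK | apply bwdK].
- now apply invertible_tensor.
- apply (invertible_abraid Y X).
Qed.

(** * The Yang-Baxter equation for lashing products *)

(* [XYXYXY -> XXXYYY] *)
Definition swap3 (X Y : C) : arrow C :=
  (aid (X \ox X) \ax abraid (Y \ox Y) X \ax aid Y) \ac
  (swap_mid X Y \ax aid (X \ox Y)).

(** The hexagon axioms split each side into three crossings of adjacent factors. The last crossing
    is common; the first two involve disjoint factors and commute. The definition suits a lashing
    product on the left four factors, this form one on the right four. *)
Lemma swap3E (X Y : C) :
  swap3 X Y =
  (aid X \ax abraid Y (X \ox X) \ax aid (Y \ox Y)) \ac
  (aid (X \ox Y) \ax swap_mid X Y).
Proof.
unfold swap3, swap_mid.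
rewrite abraid_tensor_l, abraid_tensor_r.
rewrite !atens_comp_idl, !atens_comp_idr by (simpl; now rewrite !tensorA).
rewrite !aid_tens, !atensA.
rewrite <- !acompA by (simpl; now rewrite !tensorA).
f_equal.
(* The two crossings lie in different halves of [XYX] tensored with [YXY]. *)
pose proof (atens_interchange (aid X \ax abraid Y X) (abraid Y X \ax aid Y)) as e.
simpl in e; now rewrite !aid_tens, !atensA in e.
Qed.

Lemma invertible_swap3 (X Y : C) : invertible (mor (swap3 X Y)).
Proof.
apply invertible_acomp; repeat apply invertible_tensor;
  auto using invertible_idm, invertible_abraid.
Qed.

(** First [swap_mid] separates [chi] from [gamma]; then naturality of the braiding slides [gamma]
    past the remaining factor [X]. *)
Lemma square_swap3_l (X Y : C)
    (chi : hom (X \ox X) (X \ox X)) (gamma : hom (Y \ox Y) (Y \ox Y)) :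
  square (swap3 X Y) (swap3 X Y)
    (Arrow (lash c chi gamma) \ax aid (X \ox Y))
    ((Arrow chi \ax aid X) \ax (Arrow gamma \ax aid Y)).
Proof.
apply (square_vcomp
  (square_tens (square_lash chi gamma) (square_idv (aid (X \ox Y))))
  (square_tens
    (square_tens (square_idv (Arrow chi)) (square_braid (Arrow gamma) (aid X)))
    (square_idv (aid Y)))); now rewrite ?aid_tens, ?atensA.
Qed.

Lemma square_swap3_r (X Y : C)
    (chi : hom (X \ox X) (X \ox X)) (gamma : hom (Y \ox Y) (Y \ox Y)) :
  square (swap3 X Y) (swap3 X Y)
    (aid (X \ox Y) \ax Arrow (lash c chi gamma))
    ((aid X \ax Arrow chi) \ax (aid Y \ax Arrow gamma)).
Proof.
rewrite swap3E.
apply (square_vcomp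
  (square_tens (square_idv (aid (X \ox Y))) (square_lash chi gamma))
  (square_tens
    (square_tens (square_idv (aid X)) (square_braid (aid Y) (Arrow chi)))
    (square_idv (Arrow gamma)))); now rewrite ?aid_tens, ?atensA.
Qed.

Lemma yang_baxter_lash (X Y : C)
    (chi : hom (X \ox X) (X \ox X)) (gamma : hom (Y \ox Y) (Y \ox Y)) :
  yang_baxter_equation chi -> yang_baxter_equation gamma ->
  yang_baxter_equation (lash c chi gamma).
Proof.
rewrite !yang_baxter_equationE; intros echi egamma.
pose proof (square_swap3_l chi gamma) as sl.
pose proof (square_swap3_r chi gamma) as sr.
set (x1 := Arrow chi \ax aid X) in *; set (x2 := aid X \ax Arrow chi) in *.
set (y1 := Arrow gamma \ax aid Y) in *; set (y2 := aid Y \ax Arrow gamma) in *.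
(* After transport along [swap3], the equation holds separately in the [X] and the [Y] factors. *)
assert (E : (x1 \ax y1) \ac (x2 \ax y2) \ac (x1 \ax y1) =
            (x2 \ax y2) \ac (x1 \ax y1) \ac (x2 \ax y2)).
{ rewrite <- !atens_comp; rewrite ?src_acomp; simpl; rewrite ?tensorA; try easy.
  now rewrite echi, egamma. }
apply (square_cancel (invertible_swap3 X Y)
  (square_hcomp sl (square_hcomp sr sl))).
rewrite E; exact (square_hcomp sr (square_hcomp sl sr)).
Qed.

Lemma lash_is_closed : lash_closed c.
Proof.
intros [X chi [ichi echi]] [Y gamma [igamma egamma]]; split; simpl.
- now apply invertible_lash.
- now apply yang_baxter_lash.
Qed.

(** * The unit object and tensor products of morphisms *)

Lemma Arrow_unit_chi : Arrow (unit_chi C) = aid one.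
Proof. apply Arrow_cast. Qed.

Lemma unit_is_closed : unit_closed C.
Proof.
split.
- apply invertible_cast, invertible_idm.
- apply yang_baxter_equationE.
  now rewrite Arrow_unit_chi, atens1l.
Qed.

Lemma is_YB_morE (A B : YB_ob C) (f : hom (yb_ob A) (yb_ob B)) :
  is_YB_mor f <->
  Arrow (yb_chi B) \ac (Arrow f \ax Arrow f) =
  (Arrow f \ax Arrow f) \ac Arrow (yb_chi A).
Proof.
unfold is_YB_mor, atens; simpl; rewrite <- !Arrow_comp.
split; [intros e; now rewrite e | apply Arrow_inj].
Qed.

Lemma square_swap_mid (f g : arrow C) :
  square (swap_mid (src f) (src g)) (swap_mid (tgt f) (tgt g))
    ((f \ax g) \ax (f \ax g)) ((f \ax f) \ax (g \ax g)).
Proof.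
pose proof (square_tens (square_tens (square_idv f) (square_braid g f))
  (square_idv g)) as H.
now rewrite !atensA in H |- *.
Qed.

Lemma tensor_mor_is_closed (H : lash_closed c) : tensor_mor_closed H.
Proof.
intros A A' B B' [f ef] [g eg]; apply is_YB_morE; simpl.
apply is_YB_morE in ef, eg.
pose proof (square_swap_mid (Arrow f) (Arrow g)) as sfg.
(* Past [swap_mid] the claim splits into the morphism conditions on [f] and on [g]. *)
apply (square_cancel (invertible_swap_mid _ _)
  (square_hcomp sfg (square_lash (yb_chi A') (yb_chi B')))).
rewrite <- atens_comp, ef, eg, atens_comp by easy.
exact (square_hcomp (square_lash (yb_chi A) (yb_chi B)) sfg).
Qed.

(** * Associativity and unit laws of the lashing product *)

(* [XYZXYZ -> XXYYZZ] *)
Definition swap_mid3 (X Y Z : C) : arrow C :=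
  (swap_mid X Y \ax aid (Z \ox Z)) \ac swap_mid (X \ox Y) Z.

(** Now the common crossing, that of [Z] with [X], comes first; the two later ones involve disjoint
    factors. *)
Lemma swap_mid3E (X Y Z : C) :
  swap_mid3 X Y Z = (aid (X \ox X) \ax swap_mid Y Z) \ac swap_mid X (Y \ox Z).
Proof.
unfold swap_mid3, swap_mid.
rewrite abraid_tensor_l, abraid_tensor_r.
rewrite !atens_comp_idl, !atens_comp_idr by (simpl; now rewrite !tensorA).
rewrite !aid_tens, !atensA.
rewrite !acompA by (simpl; now rewrite !tensorA).
f_equal.
pose proof (atens_interchange (aid X \ax abraid Y X) (abraid Z Y \ax aid Z)) as e.
simpl in e; rewrite !aid_tens, !atensA in e.
now symmetry.
Qed.

(** The two forms of [swap_mid3] carry the two bracketings to the same tensor product of [chi],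
    [gamma] and [delta]. *)
Lemma Arrow_lashA (X Y Z : C) (chi : hom (X \ox X) (X \ox X))
    (gamma : hom (Y \ox Y) (Y \ox Y)) (delta : hom (Z \ox Z) (Z \ox Z)) :
  Arrow (lash c chi (lash c gamma delta)) =
  Arrow (lash c (lash c chi gamma) delta).
Proof.
assert (i : invertible (mor (swap_mid3 X Y Z))).
{ apply invertible_acomp; try apply invertible_swap_mid.
  apply invertible_tensor; auto using invertible_idm.
  apply invertible_swap_mid. }
pose proof (square_vcomp (square_lash (lash c chi gamma) delta)
  (square_tens (square_lash chi gamma) (square_idv (Arrow delta)))
  eq_refl eq_refl) as H.
pose proof (square_vcomp (square_lash chi (lash c gamma delta))
  (square_tens (square_idv (Arrow chi)) (square_lash gamma delta))
  eq_refl (atensA _ _ _)) as H'.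
apply (square_cancel (p := swap_mid3 X Y Z) i) with (2 := H).
rewrite swap_mid3E; exact H'.
Qed.

(** Braiding with the unit is the identity, hence so is [swap_mid one X], and the square of
    [square_lash] has identity sides. *)
Lemma Arrow_lash1l (X : C) (chi : hom (X \ox X) (X \ox X)) :
  Arrow (lash c (unit_chi C) chi) = Arrow chi.
Proof.
pose proof (square_lash (unit_chi C) chi) as [s t _ _ e].
rewrite Arrow_unit_chi, atens1l in e.
unfold swap_mid in *; rewrite abraid1r, atens1l, <- aid_tens in *.
now rewrite acomp_idl, acomp_idr in e.
Qed.

Lemma Arrow_lash1r (X : C) (chi : hom (X \ox X) (X \ox X)) :
  Arrow (lash c chi (unit_chi C)) = Arrow chi.
Proof.
pose proof (square_lash chi (unit_chi C)) as [s t _ _ e].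
rewrite Arrow_unit_chi, atens1r in e.
unfold swap_mid in *; rewrite abraid1l, atens1r, <- aid_tens in *.
now rewrite acomp_idl, acomp_idr in e.
Qed.

End Braiding.

(** * Equality of objects and arrows in [YB C], and the monoidal axioms *)

Lemma YB_ob_eq (A B : YB_ob C) :
  yb_ob A = yb_ob B -> Arrow (yb_chi A) = Arrow (yb_chi B) -> A = B.
Proof.
destruct A as [X chi p], B as [Y gamma q]; simpl; intros e; destruct e.
intros e; apply Arrow_inj in e; destruct e.
f_equal; apply proof_irrelevance.
Qed.

(** The underlying arrow in [C] does not record the Yang-Baxter operators at its endpoints, so
    equality of the endpoints is a separate premise. *)
Lemma YB_Arrow_eq (A A' B B' : YB C) (f : @hom (YB C) A B) (g : @hom (YB C) A' B') :
  A = A' -> B = B' -> Arrow (yb_mor f) = Arrow (yb_mor g) -> Arrow f = Arrow g.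
Proof.
intros eA eB; destruct eA, eB; intros e.
f_equal; now apply YB_hom_eq, Arrow_inj.
Qed.

End Tensor.

Theorem theorem5p3 (C : strict_monoidal_category) (c : braiding C) :
  exists (H : lash_closed c) (H1 : unit_closed C) (Hm : tensor_mor_closed H),
    is_strict_monoidal (lashing_tensor H1 Hm).
Proof.
set (H := lash_is_closed c); set (one := YBOb (unit_is_closed C)).
exists H, (unit_is_closed C), (tensor_mor_is_closed H).
(* The object laws come first, since the morphism laws compare arrows whose endpoints agree only
   through them. *)
assert (lashA : forall A B D : YB C,
  lash_ob H A (lash_ob H B D) = lash_ob H (lash_ob H A B) D).
{ intros; apply YB_ob_eq; [apply tensorA | apply Arrow_lashA]. }
assert (lash1l : forall A : YB C, lash_ob H one A = A).
{ intros; apply YB_ob_eq; [apply tensor1l | apply Arrow_lash1l]. }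
assert (lash1r : forall A : YB C, lash_ob H A one = A).
{ intros; apply YB_ob_eq; [apply tensor1r | apply Arrow_lash1r]. }
split; auto; intros.
- apply YB_hom_eq, (ax_tensor_id (smc_ax C)).
- apply YB_hom_eq, (ax_tensor_comp (smc_ax C)).
- apply YB_Arrow_eq; [apply lashA .. | apply (ax_tensorA_mor (smc_ax C))].
- apply YB_Arrow_eq; [apply lash1l .. | apply (ax_tensor1l_mor (smc_ax C))].
- apply YB_Arrow_eq; [apply lash1r .. | apply (ax_tensor1r_mor (smc_ax C))].
Qed.
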